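(* Let $G$ be a simple connected graph with vertex set $[n]=\{1,2,\dots,n\}$. Then $T_G(2,-1)$ is equal to the number of even-left spanning forests of $G$.
   Context: Tutte polynomial. For a (finite) graph $G=(V,E)$, $T_G(x,y)=\sum_{A\subseteq E}(x-1)^{r(G)-r(A)}(y-1)^{|A|-r(A)}$, where $r(A)=|V|-c(A)$, $c(A)$ is the number of connected components of the spanning subgraph $(V,A)$, and $r(G)=r(E)$. Sequence of a spanning tree. Let $H$ be a simple connected graph whose vertex set is a finite totally ordered set with $m$ elements (e.g. a subset of $[n]$), and let $T$ be a spanning tree of $H$. Define an ordering $\pi_T=(\pi_T(1),\dots,\pi_T(m))$ of $V(H)$ recursively: $\pi_T(1)$ is the maximum vertex of $H$; given $\pi_T(1),\dots,\pi_T(i)$, put $U_i=\{\pi_T(1),\dots,\pi_T(i)\}$ and let $\pi_T(i+1)$ be the smallest vertex $w\in V(H)\setminus U_i$ that is joined by an edge of $T$ to some vertex of $U_i$. Write $\pi_T^{-1}(v)$ for the position of $v$ in this sequence. For $v\in V(H)\setminus\{\pi_T(1)\}$: - the predecessor $p_T(v)$ is the unique vertex $u$ with $uv\in E(T)$ and $\pi_T^{-1}(u)<\pi_T^{-1}(v)$; - $N_{T,v}$ is the set of vertices $w$ with $wv\in E(H)\setminus E(T)$ and $\pi_T^{-1}(p_T(v))<\pi_T^{-1}(w)<\pi_T^{-1}(v)$; - the $(T;v)$-rightmost inversion vertex $r$ is the unique vertex with $r>v$, $\pi_T^{-1}(r)<\pi_T^{-1}(v)$, and $\pi_T(j)<v$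 for all $\pi_T^{-1}(r)<j<\pi_T^{-1}(v)$ (i.e. the last vertex before $v$ in $\pi_T$ that is larger than $v$); - $M_{T,v}$ is the set of vertices $s$ with $sv\in E(H)\setminus E(T)$ and $\pi_T^{-1}(r)\le\pi_T^{-1}(s)<\pi_T^{-1}(p_T(v))$. The spanning tree $T$ of $H$ is even if $|N_{T,v}|$ is even for every $v\neq\pi_T(1)$; it is left if $M_{T,v}=\emptyset$ for every $v\ne\pi_T(1)$; it is even-left if it is both even and left. Even-left spanning forests. A spanning forest of $G$ is an acyclic subgraph with vertex set $V(G)$. If $F$ is a spanning forest of $G$ with connected components $T_1,\dots,T_t$, then each $T_i$ is a spanning tree of the induced subgraph $G_i=G[V(T_i)]$ (with vertex order inherited from $[n]$). $F$ is even-left if each $T_i$ is an even-left spanning tree of $G_i$. *)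

(* Defs.v *)
From HB Require Import structures.
From mathcomp Require Import all_boot all_order all_algebra.

Set Implicit Arguments.
Unset Strict Implicit.
Unset Printing Implicit Defensive.

Import GRing.Theory.

(* The vertex set is a subset of 'I_n = {0, ..., n-1}, which stands for
   [n] = {1, ..., n}; only the order of the vertices matters. An edge uv is
   the set [set u; v]. *)
Record graph (n : nat) := Graph {
  vert : {set 'I_n};
  edges : {set {set 'I_n}}
}.

Definition graph_pair n (G : graph n) := (vert G, edges G).
Definition pair_graph n (p : {set 'I_n} * {set {set 'I_n}}) := Graph p.1 p.2.
Lemma graph_pairK n : cancel (@graph_pair n) (@pair_graph n).
Proof. by case. Qed.
HB.instance Definition _ n := Finite.copy (graph n) (can_type (@graph_pairK n)).

Section Graphs.
Variable n : nat.
Implicit Types (G H T F : graph n) (W : {set 'I_n}).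

Definition simple G : bool :=
  [forall e in edges G, (e \subset vert G) && (#|e| == 2)].

Definition adj G : rel 'I_n := [rel u v | [set u; v] \in edges G].

Definition connected G : bool :=
  (vert G != set0) &&
  [forall u in vert G, forall v in vert G, connect (adj G) u v].

(* The vertex sets of the connected components. *)
Definition components G : {set {set 'I_n}} :=
  equivalence_partition (connect (adj G)) (vert G).

Definition induced G W : graph n := Graph W [set e in edges G | e \subset W].

(* A cycle has at least three vertices, all distinct, hence at most n. *)
Definition acyclic G : bool :=
  [forall k : 'I_n.+1, forall c : k.-tuple 'I_n,
     (2 < k) ==> ~~ ucycleb (adj G) c].

Lemma acyclicP G :
  reflect (forall c : seq 'I_n, 2 < size c -> ~ ucycle (adj G) c) (acyclic G).
Proof.
apply: (iffP forallP) => [acG c c_gt2 c_cycle | acG k].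
  have lt_c : size c < n.+1.
    move: (c_cycle) => /andP[_ /card_uniqP <-].
    by rewrite -[n in _ < n.+1]card_ord ltnS max_card.
  move/forallP/(_ (in_tuple c)): (acG (Ordinal lt_c)).
  by rewrite /= c_gt2 /= => /negP; apply.
apply/forallP=> c; apply/implyP=> k_gt2; apply/negP.
by apply: acG; rewrite size_tuple.
Qed.

Definition spanning_forest G F : bool :=
  [&& vert F == vert G, edges F \subset edges G & acyclic F].

Section Sequence.
Variable T : graph n.

Definition first_vertex : option 'I_n :=
  [pick v in vert T | [forall w in vert T, w <= v]].

Definition boundary (s : seq 'I_n) : {set 'I_n} :=
  [set w in vert T | (w \notin s) && has (adj T w) s].

Definition next_vertex (s : seq 'I_n) : option 'I_n :=
  [pick w in boundary s | [forall w' in boundary s, w <= w']].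

Definition extend (s : seq 'I_n) : seq 'I_n :=
  if next_vertex s is Some w then rcons s w else s.

Definition tree_seq : seq 'I_n :=
  if first_vertex is Some v then iter #|vert T|.-1 extend [:: v] else [::].

(* Positions are counted from 0, so pi_T(1) is the vertex at position 0. *)
Definition pos (v : 'I_n) : nat := index v tree_seq.

(* In the next two definitions the default v is irrelevant: if T is a tree and
   v is not the first vertex of the sequence, the sought vertex exists and is
   unique. *)
Definition pred_vertex (v : 'I_n) : 'I_n :=
  odflt v [pick u | ([set u; v] \in edges T) && (pos u < pos v)].

Definition rightmost_inversion (v : 'I_n) : 'I_n :=
  odflt v [pick r in vert T |
    [&& v < r, pos r < pos v &
        [forall j : 'I_(size tree_seq),
           (pos r < j < pos v) ==> (nth v tree_seq j < v)]]].

End Sequence.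

Definition N_set H T (v : 'I_n) : {set 'I_n} :=
  [set w | ([set w; v] \in edges H :\: edges T) &&
           (pos T (pred_vertex T v) < pos T w < pos T v)].

Definition M_set H T (v : 'I_n) : {set 'I_n} :=
  [set s | ([set s; v] \in edges H :\: edges T) &&
           (pos T (rightmost_inversion T v) <= pos T s
              < pos T (pred_vertex T v))].

Definition even_tree H T : bool :=
  [forall v in vert H, (0 < pos T v) ==> ~~ odd #|N_set H T v|].

Definition left_tree H T : bool :=
  [forall v in vert H, (0 < pos T v) ==> (M_set H T v == set0)].

Definition even_left_tree H T : bool := even_tree H T && left_tree H T.

Definition even_left_forest G F : bool :=
  spanning_forest G F &&
  [forall W in components F, even_left_tree (induced G W) (induced F W)].

Definition rank G (A : {set {set 'I_n}}) : nat :=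
  #|vert G| - #|components (Graph (vert G) A)|.

Local Open Scope ring_scope.

(* The subtractions in the exponents and in rank are in nat, but never
   truncate for A a subset of the edges of a simple graph. *)
Definition tutte (R : comNzRingType) G (x y : R) : R :=
  \sum_(A in powerset (edges G))
    (x - 1) ^+ (rank G (edges G) - rank G A)%N * (y - 1) ^+ (#|A| - rank G A)%N.

End Graphs.

(* Main.v *)
(** For a set A of edges, search every component of ([n], A) as in the
    definition of pi_T, and write A_v for the neighbours of v in A that come
    before v. A family of sequences is the search result of A exactly when every
    A_v is contained in the window W_v, formed by the G-neighbours of v between
    the rightmost inversion vertex r and v, and is nonempty unless v starts its
    sequence. Moreover |A| - r(A) is the sum over all v of |A_v| - 1 (of 0 if v
    starts its sequence). Hence the terms (-2)^(|A| - r(A)) with a prescribed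
    search result sum to the product, over the v that do not start a sequence,
    of the sum of (-2)^(|S| - 1) over the nonempty subsets S of W_v, which is 1
    if |W_v| is odd and 0 otherwise. On the other side, A is an even-left forest
    exactly when, for these v, |W_v| is odd and A_v consists of the first element
    of W_v, so that the same product counts the even-left forests with this
    search result. *)

Require Import Defs.
From mathcomp Require Import all_boot all_order all_algebra.

Set Implicit Arguments.
Unset Strict Implicit.
Unset Printing Implicit Defensive.

Import GRing.Theory.

(** * Search sequences *)

(** The stretch before [v] that begins at the last earlier vertex larger than [v], or at the start
    of [q] if there is none. Quantifying over the vertices in between avoids choosing that
    vertex. *)
Definition window n (q : seq 'I_n) (v : 'I_n) : {set 'I_n} :=
  [set s | (index s q < index v q) &&
           [forall u, (index s q < index u q < index v q) ==> (u < v)]].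

Lemma windowP n (q : seq 'I_n) v s :
  reflect (index s q < index v q /\
           forall u, index s q < index u q -> index u q < index v q -> u < v)
          (s \in window q v).
Proof.
rewrite inE; apply: (iffP andP) => -[lt_sv between]; split=> //.
  by move=> u lt_su lt_uv; move/forallP/(_ u): between; rewrite lt_su lt_uv.
by apply/forallP=> u; apply/implyP=> /andP[]; apply: between.
Qed.

(* A vertex outside q has index size q, so that search_window also constrains
   the edges that leave q; this makes the notion meaningful for the partial
   sequences met during the search. *)
Record search_order n (T : graph n) (q : seq 'I_n) : Prop := SearchOrder {
  search_uniq : uniq q;
  search_sub : {subset q <= vert T};
  search_max : forall u v, u \in vert T -> v \in q -> index v q = 0 -> u <= v;
  search_window : forall s v, v \in vert T -> [set s; v] \in edges T ->
    index s q < index v q -> s \in window q v;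
  search_pred : forall v, v \in q -> 0 < index v q ->
    exists2 s, index s q < index v q & [set s; v] \in edges T
}.

Lemma adjE n (G : graph n) u v : adj G u v = ([set u; v] \in edges G).
Proof. by []. Qed.

Lemma in_boundary n (T : graph n) (q : seq 'I_n) w :
  reflect [/\ w \in vert T, w \notin q &
              exists2 s, s \in q & [set s; w] \in edges T]
          (w \in boundary T q).
Proof.
rewrite inE; apply: (iffP and3P) => -[wT wq adj_w]; split=> //.
  by case/hasP: adj_w => s sq /= sw; exists s; rewrite // setUC.
by case: adj_w => s sq sw; apply/hasP; exists s; rewrite ?adjE 1?setUC.
Qed.

Lemma mem_of_index_lt (T : eqType) (q : seq T) u v :
  index u q < index v q -> u \in q.
Proof. by move=> lt_uv; rewrite -index_mem (leq_trans lt_uv) ?index_size. Qed.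

Lemma index_rcons (T : eqType) (q : seq T) w s :
  index s (rcons q w) =
    if s \in q then index s q else if s == w then size q else (size q).+1.
Proof.
by rewrite -cats1 index_cat /= eq_sym; do 2!case: ifP => //; rewrite ?addn0 ?addn1.
Qed.

Lemma search_order1 n (T : graph n) x :
  x \in vert T -> {in vert T, forall u : 'I_n, u <= x} -> search_order T [:: x].
Proof.
move=> xT maxx; split=> //.
- by move=> y; rewrite inE => /eqP->.
- by move=> u v uT; rewrite inE => /eqP-> _; apply: maxx.
- move=> s v vT sv lt_sv; apply/windowP; split=> // u.
  by move: lt_sv => /=; do !case: eqP.
- by move=> v; rewrite inE => /eqP-> /=; rewrite eqxx.
Qed.

(** Only vertices [v] outside [q] and other than [w] gain a new vertex before them, namely [w]. If
    such a [v] has a neighbour in [q], it lies in the boundary, so minimality of [w] gives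
    [w < v]. *)
Lemma search_order_rcons n (T : graph n) q w :
    0 < size q -> search_order T q -> w \in boundary T q ->
    {in boundary T q, forall u : 'I_n, w <= u} ->
  search_order T (rcons q w).
Proof.
move=> q_gt0 [uq subq maxq winq predq] /in_boundary[wT wq [p pq pw]] minw.
have sz_q : forall x, x \notin q -> index x q = size q by move=> x /memNindex.
have idxP x : index x (rcons q w) <= (size q).+1.
  by rewrite -(size_rcons q w) index_size.
split.
- by rewrite rcons_uniq wq.
- by move=> x; rewrite mem_rcons inE => /orP[/eqP-> //|]; apply: subq.
- move=> u v uT; rewrite mem_rcons inE index_rcons => vq'; case: ifP => [vq|].
    exact: maxq.
  by case: eqP => // _ _ q0; rewrite q0 in q_gt0.
- move=> s v vT sv lt_sv; apply/windowP; split=> // u.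
  have lt_uq : u \in q -> index u q < size q by rewrite index_mem.
  have lt_vq : v \in q -> index v q < size q by rewrite index_mem.
  (* If [s] is outside [q], its index is at least [size q], while that of [v] is at most
     [(size q).+1], so no position lies strictly between. *)
  case sq: (s \in q); last first.
    move=> lt_su /(leq_ltn_trans lt_su)/leq_trans/(_ (idxP v)).
    by rewrite !ltnS index_rcons sq; case: ifP; rewrite 1?ltnNge ?leqnn ?leqnSn.
  move: lt_sv; rewrite !index_rcons sq.
  move=> lt_sv lt_su lt_uv.
  have lt_sq : index s q < size q by rewrite index_mem.
  have lt_sv' : index s q < index v q.
    by case: ifP lt_sv => // /negbT /sz_q->.
  have /windowP[_ between] := winq s v vT sv lt_sv'.
  case uq': (u \in q) lt_su lt_uv => lt_su lt_uv.
    by apply: between => //; case: ifP lt_uv => // /negbT /sz_q->; rewrite lt_uq.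
  (* Now [u] is outside [q]; since it comes before [v], it can only be [w]. *)
  have vq : v \notin q.
    apply/negP=> vq; move: lt_uv; rewrite vq ltnNge; case/negP.
    by apply: leq_trans (ltnW (lt_vq vq)) _; case: ifP.
  move: lt_uv; rewrite (negPf vq); have [->|_] := eqVneq u w; last first.
    by rewrite ltnNge; case: ifP; rewrite ?leqnn ?leqnSn.
  case: eqVneq => [_|]; first by rewrite ltnn.
  move=> neq_vw _; rewrite ltn_neqAle eq_sym neq_vw /=; apply: minw.
  by apply/in_boundary; split=> //; exists s.
- move=> v; rewrite mem_rcons inE => /orP[/eqP-> _|vq].
    exists p => //; rewrite !index_rcons pq (negPf wq) eqxx.
    by rewrite index_mem.
  rewrite index_rcons vq => /predq-/(_ vq)[s lt_sv sv]; exists s => //.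
  rewrite index_rcons.
  by rewrite (mem_of_index_lt lt_sv).
Qed.

Lemma pick_unique (I : finType) (P : pred I) x :
  P x -> (forall y, P y -> y = x) -> [pick y | P y] = Some x.
Proof. by move=> Px uniqx; case: pickP => [y /uniqx->|/(_ x)]; rewrite ?Px. Qed.

(** The prefixes of [q] obey the recursion. The next vertex [v] of [q] is in the boundary by
    [search_pred]; any other boundary vertex [w] has a neighbour in the prefix with [v] strictly
    between the two, so [search_window] gives [v < w]. *)
Lemma tree_seq_search n (T : graph n) q :
  search_order T q -> q =i vert T -> tree_seq T = q.
Proof.
case=> uq _ maxq winq predq q_vert.
have sz_q : size q = #|vert T|.
  by rewrite -(card_uniqP uq); apply: eq_card.
rewrite /tree_seq -sz_q; case: q => [|x q'] in uq maxq winq predq q_vert sz_q *.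
  rewrite /first_vertex; case: pickP => // y /andP[].
  by rewrite -q_vert.
set q := x :: q' in uq maxq winq predq q_vert *.
have xq : x \in q by rewrite inE eqxx.
have x0 : index x q = 0 by rewrite /= eqxx.
have -> : first_vertex T = Some x.
  apply: pick_unique => [|y /andP[yT /forallP/(_ x)]].
    rewrite -q_vert xq; apply/forallP=> w; apply/implyP=> wT.
    exact: maxq wT xq x0.
  rewrite -q_vert xq /= => le_xy; apply/val_inj/eqP; rewrite eqn_leq le_xy.
  by rewrite (maxq y x yT xq x0).
suff take_q k : k < size q -> iter k (extend T) [:: x] = take k.+1 q.
  by rewrite take_q // prednK // take_size.
elim: k => [|k IHk] lt_k; first by rewrite /= take0.
rewrite iterS IHk ?(ltnW lt_k) // /extend.
set v := nth x q k.+1.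
have vq : v \in q by apply: mem_nth.
have idx_v : index v q = k.+1 by apply: index_uniq.
have bnd w : reflect [/\ w \in vert T, k < index w q &
    exists2 s, index s q <= k & [set s; w] \in edges T]
    (w \in boundary T (take k.+1 q)).
  have in_q y : (y \in take k.+1 q) = (index y q <= k).
    by rewrite in_take_leq // ltnW.
  apply: (iffP (in_boundary _ _ _)); rewrite in_q -ltnNge.
    by case=> wT wq [s sq sw]; split=> //; exists s; rewrite -?in_q.
  by case=> wT wq [s sq sw]; split=> //; exists s; rewrite ?in_q.
have v_bnd : v \in boundary T (take k.+1 q).
  apply/bnd; rewrite -q_vert idx_v; split=> //.
  by have [|s] := predq v vq; rewrite idx_v // => lt_s sv; exists s.
have v_min w : w \in boundary T (take k.+1 q) -> v <= w.
  case/bnd => wT; rewrite leq_eqVlt => /orP[/eqP eq_w _|lt_kw [s le_sk sw]].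
    have wq : w \in q by rewrite q_vert.
    by rewrite (index_inj v wq vq) // idx_v.
  have lt_sw : index s q < index w q by apply: leq_ltn_trans le_sk (ltnW lt_kw).
  have /windowP[_ between] := winq s w wT sw lt_sw.
  by apply/ltnW/between; rewrite idx_v.
have -> : next_vertex T (take k.+1 q) = Some v.
  apply: pick_unique => [|y /andP[y_bnd /forallP/(_ v)]].
    by rewrite v_bnd; apply/forallP=> w; apply/implyP; apply: v_min.
  rewrite v_bnd /= => le_yv; apply/val_inj/eqP.
  by rewrite eqn_leq le_yv v_min.
by rewrite -take_nth.
Qed.

(** Connectedness is assumed in the form of an edge leaving each proper nonempty set of vertices.
    Hence the boundary of a partial sequence is never empty, and its least vertex can be
    appended. *)
Lemma search_order_exists n (T : graph n) :
    (forall U : {set 'I_n}, U \subset vert T -> U != set0 -> U != vert T ->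
       exists s w, [/\ s \in U, w \in vert T :\: U & [set s; w] \in edges T]) ->
  exists2 q, search_order T q & q =i vert T.
Proof.
move=> crossing.
have [T0|[x0 x0T]] := set_0Vmem (vert T).
  exists [::]; last by move=> v; rewrite T0 inE.
  by split=> // s v; rewrite T0 inE.
have max_exists : exists2 x, x \in vert T & {in vert T, forall u : 'I_n, u <= x}.
  by case: (arg_maxnP (fun u : 'I_n => u : nat) x0T) => x xT maxx; exists x.
have partial k : k < #|vert T| -> exists2 q, search_order T q & size q = k.+1.
  elim: k => [_|k IHk lt_k].
    by have [x xT maxx] := max_exists; exists [:: x] => //; apply: search_order1.
  have [q q_ord sz_q] := IHk (ltnW lt_k).
  have [s [w [sq /setDP[wT wq] sw]]] : exists s w,
      [/\ s \in [set u in q], w \in vert T :\: [set u in q] &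
          [set s; w] \in edges T].
    apply: crossing.
    - by apply/subsetP=> u; rewrite inE; apply: search_sub q_ord u.
    - by apply/set0Pn; exists (nth x0 q 0); rewrite inE mem_nth // sz_q.
    - apply/eqP=> eq_qT; move: lt_k; rewrite -eq_qT -sz_q cardsE.
      by rewrite (card_uniqP (search_uniq q_ord)) ltnn.
  rewrite !inE in sq wq.
  have w_bnd : w \in boundary T q by apply/in_boundary; split=> //; exists s.
  case: (arg_minnP (fun u : 'I_n => u : nat) w_bnd) => v v_bnd v_min.
  exists (rcons q v); last by rewrite size_rcons sz_q.
  by apply: search_order_rcons => //; rewrite sz_q.
have T_gt0 : 0 < #|vert T| by apply/card_gt0P; exists x0.
have [|q q_ord] := partial #|vert T|.-1; rewrite prednK // => sz_q.
exists q => //; apply/subset_cardP; last by apply/subsetP/(search_sub q_ord).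
by rewrite (card_uniqP (search_uniq q_ord)).
Qed.

(** * Edge sets with prescribed search sequences *)

Definition spanning n (A : {set {set 'I_n}}) : graph n := Graph [set: 'I_n] A.

Definition component n (A : {set {set 'I_n}}) (v : 'I_n) : {set 'I_n} :=
  [set u | connect (adj (spanning A)) v u].

Definition component_graph n (A : {set {set 'I_n}}) (v : 'I_n) : graph n :=
  induced (spanning A) (component A v).

(** The search result of [A], stored as a function on vertices that is constant on components, so
    that it can be compared between edge sets with different components. *)
Definition orders n (A : {set {set 'I_n}}) : {ffun 'I_n -> seq 'I_n} :=
  [ffun v => tree_seq (component_graph A v)].

Lemma adj_sym n (G : graph n) : symmetric (adj G).
Proof. by move=> u v; rewrite !adjE setUC. Qed.

Lemma connect_adj_sym n (G : graph n) : connect_sym (adj G).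
Proof. exact/sym_connect_sym/adj_sym. Qed.

Lemma component_refl n (A : {set {set 'I_n}}) v : v \in component A v.
Proof. by rewrite inE connect0. Qed.

Lemma component_eq n (A : {set {set 'I_n}}) u v :
  u \in component A v -> component A u = component A v.
Proof.
rewrite inE => vu; apply/setP=> w; rewrite !inE; apply/esym.
exact: (same_connect (@connect_adj_sym _ _)).
Qed.

Lemma component_edge n (A : {set {set 'I_n}}) s v :
  [set s; v] \in A -> s \in component A v.
Proof. by move=> sv; rewrite inE connect_adj_sym connect1. Qed.

Lemma component_graph_edge n (A : {set {set 'I_n}}) s v w :
  w \in component A v ->
  ([set s; w] \in edges (component_graph A v)) = ([set s; w] \in A).
Proof.
move=> wv; rewrite inE /=; case sw: (_ \in A) => //=.
apply/subsetP=> u /set2P[]-> //.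
by rewrite -(component_eq wv) component_edge.
Qed.

Lemma closed_adj n (G : graph n) (U : {set 'I_n}) :
    (forall s w, s \in U -> [set s; w] \in edges G -> w \in U) ->
  forall v w, v \in U -> connect (adj G) v w -> w \in U.
Proof.
move=> closedU v w vU vw; rewrite -(closed_connect _ vw) // => x y.
rewrite adjE => xy; apply/idP/idP=> [xU | yU]; first exact: closedU xy.
by apply: closedU yU _; rewrite setUC.
Qed.

Lemma orders_search n (A : {set {set 'I_n}}) v :
  search_order (component_graph A v) (orders A v) /\ orders A v =i component A v.
Proof.
have [|q q_ord q_mem] := @search_order_exists n (component_graph A v).
  move=> U subU /set0Pn[u uU] neqU.
  have [w wv wU] : exists2 w, w \in component A v & w \notin U.
    by apply/subsetPn; apply: contra neqU => subU'; rewrite eqEsubset subU.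
  (* If no edge leaves [U], then [U] is closed under adjacency and contains the whole component,
     including [w]. *)
  case: (boolP [exists s in U, [exists x in component A v :\: U, [set s; x] \in A]]).
    case/exists_inP=> s sU /exists_inP[x xU sx]; exists s, x; split=> //.
    by rewrite component_graph_edge //; case/setDP: xU.
  move=> no_edge; case/negP: wU; apply: (@closed_adj _ (spanning A) _ _ u) => //.
    move=> s x sU sx; apply: contraR no_edge => xU.
    apply/exists_inP; exists s => //; apply/exists_inP; exists x => //.
    rewrite inE xU -(component_eq (subsetP subU s sU)) inE connect1 //.
  by move: (subsetP subU u uU) wv => /component_eq/= <-; rewrite inE.
rewrite ffunE (tree_seq_search q_ord q_mem); split=> //.
Qed.

Lemma orders_mem n (A : {set {set 'I_n}}) v : orders A v =i component A v.
Proof. by have [] := orders_search A v. Qed.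

(** The part of being a search result that involves no edges: a partition of the vertices into
    sequences, each starting with its maximum. *)
Record block_orders n (phi : 'I_n -> seq 'I_n) : Prop := BlockOrders {
  block_uniq : forall v, uniq (phi v);
  block_refl : forall v, v \in phi v;
  block_eq : forall u v, u \in phi v -> phi u = phi v;
  block_max : forall u v, u \in phi v -> index v (phi v) = 0 -> u <= v
}.

(** The part that involves edges. Apart from keeping edges inside the sequences, it constrains the
    earlier neighbours of each vertex separately, which is what lets the sums factor. *)
Record compatible n (A : {set {set 'I_n}}) (phi : 'I_n -> seq 'I_n) : Prop :=
  Compatible {
  compatible_block : forall s v, [set s; v] \in A -> s \in phi v;
  compatible_window : forall s v, [set s; v] \in A ->
    index s (phi v) < index v (phi v) -> s \in window (phi v) v;
  compatible_pred : forall v, 0 < index v (phi v) ->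
    exists2 s, index s (phi v) < index v (phi v) & [set s; v] \in A
}.

Lemma orders_block n (A : {set {set 'I_n}}) : block_orders (orders A).
Proof.
split=> [v|v|u v|u v].
- by have [/search_uniq] := orders_search A v.
- by have [_ ->] := orders_search A v; apply: component_refl.
- have [_ ->] := orders_search A v; move=> uv.
  by rewrite !ffunE /component_graph (component_eq uv).
- have [q_ord q_mem] := orders_search A v; rewrite q_mem => uv.
  by apply: (search_max q_ord) => //; rewrite q_mem component_refl.
Qed.

Lemma orders_compatible n (A : {set {set 'I_n}}) : compatible A (orders A).
Proof.
split=> [s v sv|s v sv lt_sv|v v_gt0]; have [q_ord q_mem] := orders_search A v.
- by rewrite q_mem component_edge.
- apply: (search_window q_ord) => //; first exact: component_refl.
  by rewrite component_graph_edge // component_refl.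
- have [|s lt_sv] := search_pred q_ord _ v_gt0; first by rewrite q_mem component_refl.
  by rewrite component_graph_edge ?component_refl // => sv; exists s.
Qed.

(** Edges of [A] never leave a sequence; conversely, passing repeatedly to an earlier neighbour
    connects every vertex to the head of its sequence. *)
Lemma block_component n (A : {set {set 'I_n}}) phi v :
  block_orders phi -> compatible A phi -> phi v =i component A v.
Proof.
move=> blk cmp u; apply/idP/idP=> [uv|]; last first.
  rewrite inE => /(@closed_adj _ _ [set x in phi v])-/(_ _ _)/[!inE]; apply.
    move=> s w; rewrite !inE => /(block_eq blk) <- /=.
    by rewrite setUC; apply: compatible_block.
  exact: block_refl.
pose h := nth v (phi v) 0.
have to_head w : w \in phi v -> connect (adj (spanning A)) h w.
  have [k] := ubnP (index w (phi v)); elim: k w => // k IHk w.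
  rewrite ltnS => le_wk wv; have [w0|w_gt0] := posnP (index w (phi v)).
    by rewrite /h -w0 nth_index ?connect0.
  have eq_wv := block_eq blk wv.
  have [|s] := compatible_pred cmp (v := w); rewrite eq_wv // => lt_sw sw.
  apply: connect_trans (IHk s _ _) (connect1 _); last by [].
    exact: leq_trans lt_sw le_wk.
  exact: (mem_of_index_lt lt_sw).
rewrite inE; apply: connect_trans (to_head u uv).
by rewrite connect_adj_sym to_head ?block_refl.
Qed.

(** The converse of [orders_block] and [orders_compatible]: the two records characterise the search
    result. *)
Lemma compatible_orders n (A : {set {set 'I_n}}) (phi : {ffun 'I_n -> seq 'I_n}) :
  block_orders phi -> compatible A phi -> orders A = phi.
Proof.
move=> blk cmp; apply/ffunP=> v; rewrite ffunE.
have mem_phi := block_component v blk cmp.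
apply: tree_seq_search => //; split.
- exact: block_uniq.
- by move=> u; rewrite mem_phi.
- move=> u w; rewrite -mem_phi => uv wv; rewrite -(block_eq blk wv).
  by apply: (block_max blk); rewrite (block_eq blk wv).
- move=> s w wv; rewrite component_graph_edge // => sw.
  rewrite -mem_phi in wv; rewrite -(block_eq blk wv).
  exact: (compatible_window cmp sw).
- move=> w wv; rewrite -(block_eq blk wv) => /(compatible_pred cmp)[s lt_sw sw].
  by exists s => //; rewrite component_graph_edge -?mem_phi.
Qed.

(** * Factorisation over the edge sets with a given search result *)

Definition lower n (phi : 'I_n -> seq 'I_n) (A : {set {set 'I_n}}) v : {set 'I_n} :=
  [set s | ([set s; v] \in A) && (index s (phi v) < index v (phi v))].

(** With [E] the edges of $G$, this is $W_v$, while [lower phi A v] is $A_v$. *)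
Definition window_nbrs n (phi : 'I_n -> seq 'I_n) (E : {set {set 'I_n}}) v :=
  [set s in window (phi v) v | [set s; v] \in E].

(** Rebuilds an edge set from its sets of earlier neighbours. *)
Definition upward n (f : {ffun 'I_n -> {set 'I_n}}) : {set {set 'I_n}} :=
  [set e | [exists v, [exists s in f v, e == [set s; v]]]].

Lemma upwardP n (f : {ffun 'I_n -> {set 'I_n}}) e :
  reflect (exists v s, s \in f v /\ e = [set s; v]) (e \in upward f).
Proof.
rewrite inE; apply: (iffP existsP) => [[v /exists_inP[s sv /eqP->]]|[v [s [sv ->]]]].
  by exists v, s.
by exists v; apply/exists_inP; exists s.
Qed.

Lemma set2_eq (T : finType) (a b c d : T) :
  [set a; b] = [set c; d] -> (a = c /\ b = d) \/ (a = d /\ b = c).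
Proof.
move=> eq_ab; have /set2P a_cd : a \in [set c; d] by rewrite -eq_ab set21.
have /set2P b_cd : b \in [set c; d] by rewrite -eq_ab set22.
have /set2P c_ab : c \in [set a; b] by rewrite eq_ab set21.
have /set2P d_ab : d \in [set a; b] by rewrite eq_ab set22.
by case: a_cd b_cd c_ab d_ab => -> [] -> [] ? [] ?; auto.
Qed.

Lemma lower_sub n (phi : {ffun 'I_n -> seq 'I_n}) (E A : {set {set 'I_n}}) v :
  compatible A phi -> A \subset E -> lower phi A v \subset window_nbrs phi E v.
Proof.
move=> cmp subAE; apply/subsetP=> s; rewrite !inE => /andP[sv lt_sv].
have := compatible_window cmp sv lt_sv.
by rewrite inE => ->; rewrite (subsetP subAE).
Qed.

Lemma lower_neq0 n (phi : {ffun 'I_n -> seq 'I_n}) (A : {set {set 'I_n}}) v :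
  compatible A phi -> (0 < index v (phi v)) = (lower phi A v != set0).
Proof.
move=> cmp; apply/idP/set0Pn=> [/(compatible_pred cmp)[s lt_sv sv]|[s]].
  by exists s; rewrite inE sv.
by rewrite inE => /andP[_]; apply: leq_ltn_trans.
Qed.

Lemma edge_lower n (phi : {ffun 'I_n -> seq 'I_n}) (A : {set {set 'I_n}}) e :
    block_orders phi -> compatible A phi -> e \in A -> #|e| = 2 ->
  exists v s, s \in lower phi A v /\ e = [set s; v].
Proof.
move=> blk cmp eA /eqP/cards2P[s [v [neq_sv def_e]]]; rewrite def_e in eA *.
have sv := compatible_block cmp eA.
have eq_sv := block_eq blk sv.
case: (ltngtP (index s (phi v)) (index v (phi v))) => [lt_sv|lt_vs|eq_idx].
- by exists v, s; rewrite inE eA.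
- by exists s, v; rewrite inE eq_sv [[set v; s]]setUC eA.
- by case/eqP: neq_sv; apply: (index_inj v sv _ eq_idx); apply: block_refl.
Qed.

(** Taking earlier neighbours is a bijection from the edge sets with search result [phi] to the
    independent choices, at each vertex, of an admissible subset of its window. Distributivity then
    turns the sum of products into a product of sums. *)
Lemma sum_orders n (R : comNzRingType) (E : {set {set 'I_n}})
    (phi : {ffun 'I_n -> seq 'I_n}) (w : 'I_n -> {set 'I_n} -> R) :
    {in E, forall e : {set 'I_n}, #|e| = 2} -> block_orders phi ->
  (\sum_(A : {set {set 'I_n}} | (A \subset E) && (orders A == phi))
     \prod_v w v (lower phi A v) =
   \prod_v \sum_(S : {set 'I_n} | (S \subset window_nbrs phi E v) &&
                     ((0 < index v (phi v))%N ==> (S != set0))) w v S)%R.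
Proof.
move=> simpleE blk; rewrite bigA_distr_big_dep.
pose down (A : {set {set 'I_n}}) := [ffun v => lower phi A v].
have cmpP A : orders A == phi -> compatible A phi.
  by move/eqP<-; apply: orders_compatible.
(* [upward] undoes [down] because every edge has two distinct ends and is recorded at the later
   one. *)
rewrite (reindex_onto (@upward n) down) /=; last first.
  move=> A /andP[subAE /cmpP cmp]; apply/setP=> e; apply/upwardP/idP=> [|eA].
    by case=> v [s [+ ->]]; rewrite ffunE inE => /andP[].
  have [v [s [sv def_e]]] := edge_lower blk cmp eA (simpleE e (subsetP subAE e eA)).
  by exists v, s; rewrite ffunE.
apply: eq_big => [f|f /andP[_ /eqP def_f]]; last first.
  by apply: eq_bigr => v _; rewrite -[in RHS]def_f ffunE.
apply/idP/familyP=> [/andP[/andP[subE /cmpP cmp] /eqP def_f] v|f_ok].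
  rewrite -def_f ffunE unfold_in lower_sub //=.
  by rewrite -lower_neq0 ?implybb.
have f_win s v : s \in f v -> s \in window_nbrs phi E v.
  by have := f_ok v; rewrite unfold_in => /andP[/subsetP sub_f _]; apply: sub_f.
have f_lt s v : s \in f v -> index s (phi v) < index v (phi v).
  by move/f_win; rewrite inE => /andP[/windowP[]].
have f_mem s v : s \in f v -> s \in phi v.
  by move/f_lt/mem_of_index_lt.
(* The edge could also have been recorded with its ends exchanged, but then [v] would precede
   [s]. *)
have f_up s v : [set s; v] \in upward f ->
    index s (phi v) < index v (phi v) -> s \in f v.
  case/upwardP=> v' [s' [sv' /set2_eq[[-> ->]|[-> ->]]]] // lt_vs.
  by have := f_lt _ _ sv'; rewrite -(block_eq blk (f_mem _ _ sv')) ltnNge ltnW.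
have subE : upward f \subset E.
  apply/subsetP=> e /upwardP[v [s [/f_win + ->]]].
  by rewrite inE => /andP[].
have cmp : compatible (upward f) phi.
  split=> [s v|s v sv lt_sv|v v_gt0].
  - case/upwardP=> v' [s' [sv' /set2_eq[[-> ->]|[-> ->]]]]; first exact: f_mem.
    by rewrite (block_eq blk (f_mem _ _ sv')) block_refl.
  - by have /f_win := f_up s v sv lt_sv; rewrite inE => /andP[].
  - have := f_ok v; rewrite unfold_in v_gt0 => /andP[_ /set0Pn[s sv]].
    by exists s; [apply: f_lt | apply/upwardP; exists v, s].
rewrite subE (compatible_orders blk cmp) eqxx /=.
apply/eqP/ffunP=> v; apply/setP=> s; rewrite ffunE inE.
apply/andP/idP=> [[]|sv]; first exact: f_up.
by split; [apply/upwardP; exists v, s | apply: f_lt].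
Qed.

(** * Sums and ranks *)

Lemma sum_subset_exp (R : comNzRingType) (T : finType) (W : {set T}) (x : R) :
  (\sum_(S : {set T} | S \subset W) x ^+ #|S| = (1 + x) ^+ #|W|)%R.
Proof.
pose F i : R := if i \in W then x else 0%R.
have -> : ((1 + x) ^+ #|W| = \prod_i (F i + 1))%R.
  rewrite -prodr_const big_mkcond; apply: eq_bigr => i _.
  by rewrite /F; case: ifP => _; rewrite ?add0r // addrC.
rewrite bigA_distr big_mkcond; apply: eq_bigr => S _.
rewrite -big_mkcond; case: ifP => [/subsetP subSW | /negbT/subsetPn[i iS iW]].
  by rewrite -prodr_const; apply: eq_bigr => i /subSW iW; rewrite /F iW.
by rewrite (bigD1 i) //= {1}/F (negPf iW) mul0r.
Qed.

(** After multiplication by -2 the sum runs over all subsets except the empty one and equals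
    $(1-2)^{|W|}-1$, which is -2 or 0 according to the parity of $|W|$. *)
Lemma sum_nonempty_subset_exp (T : finType) (W : {set T}) :
  (\sum_(S : {set T} | (S \subset W) && (S != set0)) (-2) ^+ #|S|.-1
     = (odd #|W|)%:R :> int)%R.
Proof.
apply: (@mulfI _ (-2)%R) => //; rewrite mulr_sumr.
have -> : (-2 * (odd #|W|)%:R = (1 - 2) ^+ #|W| - 1 :> int)%R.
  by rewrite -[RHS]/((-1) ^+ _ - 1)%R -signr_odd; case: odd.
rewrite -sum_subset_exp [in RHS](bigD1 set0) ?sub0set //= cards0 expr0 addrAC subrr add0r.
by apply: eq_bigr => S /andP[_]; rewrite -card_gt0 -exprS => /prednK->.
Qed.

(** An odd [W] is nonempty, and only the singleton of its unique [f]-minimal element contributes. *)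
Lemma sum_first (R : nzRingType) (T : finType) (W : {set T}) (f : T -> nat) :
    {in W &, injective f} ->
  (\sum_(S : {set T} | (S \subset W) && (S != set0))
     (odd #|W| && [exists s in W, (S == [set s]) && [forall t in W, f s <= f t]]%N)%:R
     = (odd #|W|)%:R :> R)%R.
Proof.
move=> f_inj; case oddW: (odd #|W|); last by rewrite big1.
have /set0Pn[s0 s0W] : W != set0 by apply: contraTneq oddW => ->; rewrite cards0.
case: (arg_minnP f s0W) => s sW s_min.
have {}sW : s \in W by [].
have s_first : [forall t in W, f s <= f t] by apply/forall_inP.
rewrite (bigD1 [set s]) /=; last by rewrite sub1set sW -card_gt0 cards1.
have -> : [exists s' in W, ([set s] == [set s']) && [forall t in W, f s' <= f t]].
  by apply/exists_inP; exists s; rewrite ?eqxx.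
rewrite big1 ?addr0 // => S /andP[_ neqS]; case: exists_inP => //.
case=> t tW /andP[/eqP def_S /forall_inP t_min]; case/eqP: neqS.
rewrite def_S; congr [set _]; apply: f_inj => //.
by apply/eqP; rewrite eqn_leq s_min // t_min.
Qed.

(* The even-left condition at v for a forest F with F_v = S, in terms of W_v:
   M_{T,v} is empty iff p_T(v) is the first element of W_v, and then W_v consists
   of p_T(v) and N_{T,v}. *)
Definition leftmost_at n (phi : 'I_n -> seq 'I_n) E v (S : {set 'I_n}) : bool :=
  (0 < index v (phi v)) ==>
  (odd #|window_nbrs phi E v| &&
   [exists s in window_nbrs phi E v, (S == [set s]) &&
     [forall t in window_nbrs phi E v, index s (phi v) <= index t (phi v)]]).

(** The local identity between the two counts: away from the start of a sequence, both sides are the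
    parity of $|W_v|$. *)
Lemma sum_vertex n (phi : {ffun 'I_n -> seq 'I_n}) (E : {set {set 'I_n}}) v :
  (\sum_(S : {set 'I_n} | (S \subset window_nbrs phi E v) &&
           ((0 < index v (phi v))%N ==> (S != set0))) (-2) ^+ #|S|.-1
   = \sum_(S : {set 'I_n} | (S \subset window_nbrs phi E v) &&
           ((0 < index v (phi v))%N ==> (S != set0)))
       (leftmost_at phi E v S)%:R :> int)%R.
Proof.
rewrite /leftmost_at; case: posnP => [v0|v_gt0] /=.
  (* At the start of a sequence only the empty [S] remains, and its exponent [0.-1] is 0, so its
     term is 1 on both sides. *)
  have -> : window_nbrs phi E v = set0.
    by apply/setP=> s; rewrite !inE v0.
  apply: eq_bigr => S /[!subset0] /andP[/eqP-> _].
  by rewrite cards0.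
have win_mem s : s \in window_nbrs phi E v -> s \in phi v.
  rewrite inE => /andP[/windowP[lt_sv _] _].
  exact: (mem_of_index_lt lt_sv).
rewrite sum_nonempty_subset_exp sum_first // => s t /win_mem sv /win_mem tv.
exact: (index_inj v sv tv).
Qed.

(** [J] may be infinite, as it is for families of sequences; the fibres, being subsets of [I],
    provide a finite index set for the partition. *)
Lemma eq_sum_fibers (R : nmodType) (I : finType) (J : eqType) (P : pred I) (f : I -> J)
    (F1 F2 : I -> R) :
    (forall j, (\sum_(i | P i && (f i == f j)) F1 i =
                \sum_(i | P i && (f i == f j)) F2 i)%R) ->
  (\sum_(i | P i) F1 i = \sum_(i | P i) F2 i)%R.
Proof.
move=> eqF; pose fib i := [set j | f j == f i].
have fibE i j : (fib i == fib j) = (f i == f j).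
  apply/eqP/eqP=> [/setP/(_ i)|eq_f]; last by apply/setP=> k; rewrite !inE eq_f.
  by rewrite !inE eqxx => /esym/eqP.
rewrite !(partition_big fib xpredT) //=; apply: eq_bigr => C _.
case: (pickP (fun j => fib j == C)) => [j /eqP<-|no_j].
  have fibj F : (\sum_(i | P i && (fib i == fib j)) F i =
                 \sum_(i | P i && (f i == f j)) F i :> R)%R.
    by apply: eq_bigl => i; rewrite fibE.
  by rewrite !fibj.
by rewrite !big1 // => i; rewrite no_j andbF.
Qed.

(** * Components, edges and corank counted vertex by vertex *)

Lemma components_spanning n (A : {set {set 'I_n}}) :
  components (spanning A) = [set component A v | v : 'I_n].
Proof.
rewrite /components /equivalence_partition /=; apply/setP=> W.
by apply/imsetP/imsetP=> -[v _ ->]; exists v; rewrite ?inE //;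
  apply/setP=> u; rewrite !inE.
Qed.

(** Each component is represented by the head of its sequence. *)
Lemma card_components n (A : {set {set 'I_n}}) :
  #|components (spanning A)| = #|[set v | index v (orders A v) == 0]|.
Proof.
have blk := orders_block A.
rewrite components_spanning -(@card_in_imset _ _ (component A)) => [|u v].
  apply: eq_card => W; apply/imsetP/imsetP=> -[v vP ->]; last by exists v.
  pose h := nth v (orders A v) 0.
  have hv : h \in orders A v.
    by rewrite mem_nth // -has_predT; apply/hasP; exists v => //; apply: block_refl.
  exists h; last by rewrite (component_eq (u := h) (v := v)) // -(orders_mem A).
  rewrite inE (block_eq blk hv) /h index_uniq ?(block_uniq blk) //.
  by rewrite -has_predT; apply/hasP; exists v => //; apply: block_refl.
rewrite !inE => /eqP u0 /eqP v0 eq_uv.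
have uv : u \in orders A v by rewrite (orders_mem A) -eq_uv component_refl.
rewrite (block_eq blk uv) in u0.
by apply: (index_inj v uv (block_refl blk v)); rewrite u0 v0.
Qed.

(** Each edge is counted once, at its later end. *)
Lemma card_lower n (A : {set {set 'I_n}}) :
    {in A, forall e : {set 'I_n}, #|e| = 2} ->
  #|A| = \sum_v #|lower (orders A) A v|.
Proof.
move=> simpleA; have blk := orders_block A; have cmp := orders_compatible A.
pose D := [set x : 'I_n * 'I_n | x.2 \in lower (orders A) A x.1].
have defA : A = [set [set x.2; x.1] | x in D].
  apply/setP=> e; apply/idP/imsetP=> [eA|[[v s]]].
    have [v [s [sv def_e]]] := edge_lower blk cmp eA (simpleA e eA).
    by exists (v, s); rewrite ?[_ \in D]in_set.
  by rewrite !inE => /andP[sv _] ->.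
rewrite [in LHS]defA card_in_imset => [|[v s] [v' s'] /=]; last first.
  rewrite !inE /= => /andP[sv lt_sv] /andP[sv' lt_sv'] /set2_eq[[-> ->] //|[es ev]].
  move: lt_sv' sv; rewrite -es -ev => lt_vs /(compatible_block cmp) /(block_eq blk).
  by move=> eq_vs; move: lt_sv; rewrite -eq_vs ltnNge ltnW.
rewrite -sum1_card (eq_bigl (fun x => predT x.1 && (x.2 \in lower (orders A) A x.1))).
  rewrite -(pair_big_dep predT (fun v s => s \in lower _ A v) (fun _ _ => 1)) /=.
  by apply: eq_bigr => v _; rewrite sum1_card.
by move=> x; rewrite inE.
Qed.

(** The rank is the number of vertices that do not start a sequence, that is, of those with an
    earlier neighbour; so it takes one from each nonempty [lower] set. *)
Lemma corank_lower n (G : graph n) (A : {set {set 'I_n}}) :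
    vert G = [set: 'I_n] -> {in A, forall e : {set 'I_n}, #|e| = 2} ->
  #|A| - rank G A = \sum_v #|lower (orders A) A v|.-1.
Proof.
move=> vertG simpleA; have cmp := orders_compatible A.
rewrite /rank vertG card_components cardsT card_ord.
have -> : n - #|[set v | index v (orders A v) == 0]|
          = \sum_v (0 < index v (orders A v)).
  transitivity #|~: [set v | index v (orders A v) == 0]|.
    by rewrite [RHS]cardsCs setCK card_ord.
  rewrite -sum1_card big_mkcond; apply: eq_bigr => v _.
  by rewrite !inE lt0n; case: eqP.
rewrite card_lower //; apply/eqP.
rewrite (_ : \sum_v #|lower (orders A) A v| = \sum_v #|lower (orders A) A v|.-1 +
   \sum_v (0 < index v (orders A v))) ?addnK // -big_split.
apply: eq_bigr => v _; rewrite (lower_neq0 _ cmp) -card_gt0.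
by case: #|lower _ A v| => //= m; rewrite addn1.
Qed.

(** * Even-left forests *)

(* Two edges from v to earlier vertices close up to a cycle, because all
   earlier vertices of the block are connected to its root without v. *)
Lemma acyclic_lower n (A : {set {set 'I_n}}) v :
  acyclic (spanning A) -> #|lower (orders A) A v| <= 1.
Proof.
move=> /acyclicP acA; have blk := orders_block A; have cmp := orders_compatible A.
rewrite leqNgt; apply/negP=> /card_gt1P[s [t [sv tv neq_st]]].
move: sv tv; rewrite !inE => /andP[sv lt_sv] /andP[tv lt_tv].
pose q := orders A v; pose h := nth v q 0.
(* Adjacency after deletion of [v], so that a path from [s] to [t] cannot pass through [v]. *)
pose e := [rel x y | [&& adj (spanning A) x y, x != v & y != v]].
have e_sym : connect_sym e.
  by apply: sym_connect_sym => x y; rewrite /= adj_sym [(x != v) && _]andbC.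
have to_head w : index w q < index v q -> connect e h w.
  have [k] := ubnP (index w q); elim: k w => // k IHk w.
  rewrite ltnS => le_wk lt_wv.
  have wq : w \in q := (mem_of_index_lt lt_wv).
  have [w0|w_gt0] := posnP (index w q); first by rewrite /h -w0 nth_index ?connect0.
  have [|x] := compatible_pred cmp (v := w); rewrite (block_eq blk wq) // => lt_xw xw.
  have lt_xv := ltn_trans lt_xw lt_wv.
  apply: connect_trans (IHk x (leq_trans lt_xw le_wk) lt_xv) (connect1 _).
  rewrite /= adjE xw /=.
  by apply/andP; split; [move: lt_xv | move: lt_wv]; apply: contraTneq => ->;
     rewrite ltnn.
have /connectP[p0 e_p0 def_t] : connect e s t.
  by apply: connect_trans (to_head t lt_tv); rewrite e_sym to_head.
move: def_t; case/shortenP: e_p0 => p e_p uniq_p _ def_t.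
have neq_sv : s != v by apply: contraTneq lt_sv => ->; rewrite ltnn.
have vp : v \notin p.
  elim: p (s) e_p {uniq_p def_t} => //= y p IHp x /andP[/and3P[_ _ neq_y] /IHp].
  by rewrite inE eq_sym negb_or neq_y.
have adj_p : path (adj (spanning A)) s p.
  by apply: sub_path e_p => x y /andP[].
apply: (acA (v :: s :: p)).
  by case: p def_t {e_p uniq_p vp adj_p} => // def_t; rewrite def_t eqxx in neq_st.
rewrite /ucycle /ucycleb cons_uniq uniq_p inE eq_sym negb_or neq_sv vp /= !andbT.
by rewrite rcons_path adj_p -def_t adjE setUC sv adjE tv.
Qed.

(* On a cycle, the vertex of largest index would have two distinct earlier
   neighbours. *)
Lemma lower_acyclic n (A : {set {set 'I_n}}) :
    {in A, forall e : {set 'I_n}, #|e| = 2} ->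
    (forall v, #|lower (orders A) A v| <= 1) -> acyclic (spanning A).
Proof.
move=> simpleA lowerA; apply/acyclicP=> c c_gt2 /andP[cyc_c uniq_c].
have blk := orders_block A; have cmp := orders_compatible A.
have [x0 x0c] : exists x0, x0 \in c.
  by case: c c_gt2 {cyc_c uniq_c} => // x c _; exists x; rewrite inE eqxx.
pose idx v := index v (orders A v).
case: (arg_maxnP idx x0c) => x xc x_max; have {}xc : x \in c by [].
(* Adjacent vertices share a sequence, so their indices are comparable, and equal indices would make
   the edge a singleton. *)
have low y : y \in c -> [set y; x] \in A -> y \in lower (orders A) A x.
  move=> yc yx; rewrite inE yx ltn_neqAle /=.
  have yx' := compatible_block cmp yx.
  have le_yx : idx y <= idx x by apply: x_max.
  move: le_yx; rewrite /idx (block_eq blk yx') => ->; rewrite andbT.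
  apply/negP=> /eqP/(index_inj x yx' (block_refl blk x)) eq_yx.
  by have := simpleA _ yx; rewrite eq_yx setUid cards1.
(* Rotated to start at [x], the cycle shows the two neighbours of [x] as its second and last
   entries. *)
have [i p def_c] := rot_to xc.
have mem_p y : y \in x :: p -> y \in c by rewrite -def_c mem_rot.
have uniq_p : uniq (x :: p) by rewrite -def_c rot_uniq.
have cyc_p : cycle (adj (spanning A)) (x :: p) by rewrite -def_c rot_cycle.
have size_p : 2 < size (x :: p) by rewrite -def_c size_rot.
clear i def_c.
case: p => [|y p] // in mem_p uniq_p cyc_p size_p *.
case/lastP: p => [|p z] // in mem_p uniq_p cyc_p size_p *.
have yc : y \in c by apply: mem_p; rewrite !inE eqxx orbT.
have zc : z \in c by apply: mem_p; rewrite !inE mem_rcons inE eqxx !orbT.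
have neq_yz : y != z.
  by apply: contraTneq uniq_p => ->; rewrite /= mem_rcons inE eqxx andbF.
move: cyc_p; rewrite /= rcons_path last_rcons !adjE => /and3P[xy _ zx].
have := lowerA x; rewrite leqNgt => /negP; apply; apply/card_gt1P.
exists y, z; split=> //; last exact: low.
by apply: low; rewrite // setUC.
Qed.

(** * Predecessors, rightmost inversions and the sets $N$ and $M$ *)

Lemma pred_vertexE n (A : {set {set 'I_n}}) v p :
  lower (orders A) A v = [set p] -> pred_vertex (component_graph A v) v = p.
Proof.
move=> /setP lowerE; rewrite /pred_vertex.
have lowE y : (([set y; v] \in edges (component_graph A v)) &&
    (pos (component_graph A v) y < pos (component_graph A v) v)) = (y == p).
  have := lowerE y; rewrite in_set1 [y \in lower _ _ _]in_set ffunE => <-.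
  by rewrite component_graph_edge ?component_refl.
by rewrite (@pick_unique _ _ p) => [|/=|y /=]; rewrite ?lowE ?eqxx // => /eqP.
Qed.

(** The window begins at the rightmost inversion vertex. That vertex exists since the head [h] of
    the sequence is the maximum of the component and differs from [v], so the default value is never
    returned. *)
Lemma rightmost_inversionE n (A : {set {set 'I_n}}) v s :
    0 < index v (orders A v) -> index s (orders A v) < index v (orders A v) ->
  (index (rightmost_inversion (component_graph A v) v) (orders A v)
     <= index s (orders A v)) = (s \in window (orders A v) v).
Proof.
move=> v_gt0 lt_sv; have blk := orders_block A; have cmp := orders_compatible A.
have def_q : tree_seq (component_graph A v) = orders A v by rewrite ffunE.
have memq := orders_mem A v.
rewrite /rightmost_inversion /pos def_q.
set q := orders A v in v_gt0 lt_sv def_q memq *.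
have vq : v \in q := block_refl blk v.
have uq : uniq q := block_uniq blk v.
have idx_mem u : index u q < index v q -> u \in q.
  exact: mem_of_index_lt.
pose big := [pred u | (index u q < index v q) && (v < u)].
pose h := nth v q 0.
have big_h : big h.
  have q_gt0 : 0 < size q by rewrite (leq_trans _ (index_size v q)).
  have h0 : index h q = 0 by rewrite index_uniq.
  have hq : h \in q by apply: mem_nth.
  rewrite /= h0 v_gt0 /= ltn_neqAle; apply/andP; split.
    by apply: contraTneq v_gt0 => /val_inj->; rewrite h0.
  by apply: (block_max blk); rewrite (block_eq blk hq).
case: (arg_maxnP (fun u => index u q) big_h) => r /andP[lt_rv lt_vr] max_r.
have r_max u : index u q < index v q -> v < u -> index u q <= index r q.
  by move=> lt_uv lt_vu; apply: max_r; rewrite /= lt_uv.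
have after_r u : index r q < index u q -> index u q < index v q -> u < v.
  move=> lt_ru lt_uv; rewrite ltn_neqAle; apply/andP; split.
    by apply: contraTneq lt_uv => /val_inj->; rewrite ltnn.
  rewrite leqNgt; apply: contraL lt_ru => lt_vu; rewrite -leqNgt.
  exact: r_max.
(* Translates the quantification over positions in [rightmost_inversion] into one over vertices, as
   in [window]. *)
have betweenP x : reflect
    (forall u, index x q < index u q -> index u q < index v q -> u < v)
    [forall j : 'I_(size q), (index x q < j < index v q) ==> (nth v q j < v)].
  apply: (iffP forallP) => [all_j u lt_xu lt_uv|all_u j].
    have uq' := idx_mem u lt_uv; rewrite -index_mem in uq'.
    have := all_j (Ordinal uq'); rewrite /= lt_xu lt_uv /=.
    by rewrite nth_index // -index_mem.
  apply/implyP=> /andP[lt_xj lt_jv].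
  by apply: all_u; rewrite index_uniq.
rewrite (@pick_unique _ _ r) /=; last 2 first.
- by rewrite -memq idx_mem // lt_vr lt_rv; apply/betweenP.
- move=> y /and4P[_ lt_vy lt_yv /betweenP after_y].
  apply/(index_inj v (idx_mem y lt_yv) (idx_mem r lt_rv))/eqP.
  rewrite eqn_leq r_max // leqNgt; apply: contraL lt_vr => lt_yr.
  by rewrite -leqNgt ltnW ?after_y.
apply/idP/windowP=> [le_rs|[_ after_s]].
  by split=> // u lt_su; apply: after_r; apply: leq_ltn_trans lt_su.
rewrite leqNgt; apply: contraL lt_vr => lt_sr.
by rewrite -leqNgt ltnW ?after_s.
Qed.

Lemma edges_induced_diff n (G : graph n) (A : {set {set 'I_n}}) v w :
    w \in component A v ->
  ([set w; v] \in edges (induced G (component A v)) :\: edges (component_graph A v))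
    = ([set w; v] \in edges G) && ([set w; v] \notin A).
Proof.
move=> wv; rewrite in_setD component_graph_edge ?component_refl // inE andbC.
congr (_ && _); rewrite andb_idr // => _.
by apply/subsetP=> u /set2P[]->; rewrite ?component_refl.
Qed.

(** As [p] is in the window of [v], so is everything between [p] and [v]; and no edge to a vertex
    there is in [A], because [p] is the only earlier neighbour. *)
Lemma N_setE n (G : graph n) (A : {set {set 'I_n}}) v p :
    lower (orders A) A v = [set p] ->
  N_set (induced G (component A v)) (component_graph A v) v =
  [set w in window_nbrs (orders A) (edges G) v |
     index p (orders A v) < index w (orders A v)].
Proof.
move=> lowerE; have cmp := orders_compatible A.
have def_q : tree_seq (component_graph A v) = orders A v by rewrite ffunE.
have : p \in lower (orders A) A v by rewrite lowerE set11.
rewrite in_set => /andP[pv lt_pv].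
apply/setP=> w; rewrite in_set (pred_vertexE lowerE) /pos def_q.
rewrite [RHS]in_set [w \in window_nbrs _ _ _]in_set.
apply/andP/andP=> [[edge_wv /andP[lt_pw lt_wv]]|[/andP[w_win wv] lt_pw]].
  have wA : w \in component A v.
    by rewrite -orders_mem (mem_of_index_lt lt_wv).
  move: edge_wv; rewrite edges_induced_diff // => /andP[-> _].
  split=> //; rewrite andbT; apply/windowP; split=> // u lt_wu.
  have /windowP[_ after_p] := compatible_window cmp pv lt_pv.
  exact: after_p (ltn_trans lt_pw lt_wu).
have /windowP[lt_wv _] := w_win.
have wA : w \in component A v.
  by rewrite -orders_mem (mem_of_index_lt lt_wv).
rewrite edges_induced_diff // wv lt_pw lt_wv; split=> //=.
apply/negP=> wvA; have : w \in lower (orders A) A v by rewrite in_set wvA.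
by rewrite lowerE in_set1 => /eqP eq_wp; rewrite eq_wp ltnn in lt_pw.
Qed.

(** The lower bound on positions in [M_set] is window membership by [rightmost_inversionE]. *)
Lemma M_setE n (G : graph n) (A : {set {set 'I_n}}) v p :
    lower (orders A) A v = [set p] ->
  M_set (induced G (component A v)) (component_graph A v) v =
  [set w in window_nbrs (orders A) (edges G) v |
     index w (orders A v) < index p (orders A v)].
Proof.
move=> lowerE; have cmp := orders_compatible A.
have def_q : tree_seq (component_graph A v) = orders A v by rewrite ffunE.
have : p \in lower (orders A) A v by rewrite lowerE set11.
rewrite in_set => /andP[pv lt_pv].
apply/setP=> w; rewrite in_set (pred_vertexE lowerE) /pos def_q.
rewrite [RHS]in_set [w \in window_nbrs _ _ _]in_set.
case lt_wp: (_ < index p _); last by rewrite !andbF.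
have lt_wv := ltn_trans lt_wp lt_pv.
have wA : w \in component A v.
  by rewrite -orders_mem (mem_of_index_lt lt_wv).
have v_gt0 := leq_ltn_trans (leq0n _) lt_pv.
rewrite !andbT rightmost_inversionE // edges_induced_diff //.
rewrite andbC; congr (_ && _); rewrite andb_idr // => _.
apply/negP=> wvA; have : w \in lower (orders A) A v by rewrite in_set wvA.
by rewrite lowerE in_set1 => /eqP eq_wp; rewrite eq_wp ltnn in lt_wp.
Qed.

(** The window neighbours split into those before [p], [p] itself, and those after it. If the first
    part is empty, their number is odd exactly when the last part is even. *)
Lemma leftmost_atE n (phi : 'I_n -> seq 'I_n) (E : {set {set 'I_n}}) v p :
    p \in window_nbrs phi E v ->
  leftmost_at phi E v [set p] =
    ((0 < index v (phi v)) ==>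
     ~~ odd #|[set w in window_nbrs phi E v | index p (phi v) < index w (phi v)]| &&
     ([set w in window_nbrs phi E v | index w (phi v) < index p (phi v)] == set0)).
Proof.
move=> pW; rewrite /leftmost_at; set W := window_nbrs phi E v in pW *.
set N := [set w in W | _]; set M := [set w in W | _ < index p _].
congr (_ ==> _).
have -> : [exists s in W, ([set p] == [set s]) &&
    [forall t in W, index s (phi v) <= index t (phi v)]] = (M == set0).
  apply/exists_inP/eqP=> [[s sW /andP[/eqP/set1_inj <- /forall_inP p_min]]|M0].
    apply/setP=> t; rewrite in_set in_set0; apply/negP=> /andP[/p_min].
    by rewrite leqNgt => /negP.
  exists p; rewrite // eqxx; apply/forall_inP=> t tW; rewrite leqNgt; apply/negP=> lt_tp.
  by have : t \in M by [rewrite in_set tW]; rewrite M0 inE.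
case: eqP => [M0|]; rewrite ?andbF // !andbT.
have W_mem w : w \in W -> w \in phi v.
  by rewrite inE => /andP[/windowP[/mem_of_index_lt]].
have -> : W = p |: N.
  apply/setP=> w; rewrite in_setU1 [w \in N]in_set.
  have [->|neq_wp] := eqVneq w p; first by rewrite pW.
  case wW: (w \in W) => //=; apply/esym; rewrite ltn_neqAle leqNgt; apply/andP; split.
    apply: contra neq_wp => /eqP eq_idx; apply/eqP.
    exact: (index_inj v (W_mem w wW) (W_mem p pW) (esym eq_idx)).
  apply/negP=> lt_wp.
  by have : w \in M by [rewrite in_set wW]; rewrite M0 inE.
by rewrite cardsU1 [p \in N]in_set ltnn andbF.
Qed.

(** Both sides force at most one earlier neighbour per vertex, the left one through acyclicity. The
    predecessor is then determined, and the conditions on $N$ and $M$ translate vertex by vertex. *)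
Lemma even_left_forestE n (G : graph n) (A : {set {set 'I_n}}) :
    vert G = [set: 'I_n] -> simple G -> A \subset edges G ->
  even_left_forest G (spanning A) =
  [forall v, leftmost_at (orders A) (edges G) v (lower (orders A) A v)].
Proof.
move=> vertG simpleG subAG; have cmp := orders_compatible A.
have simpleA : {in A, forall e : {set 'I_n}, #|e| = 2}.
  by move=> e /(subsetP subAG) eG; have /andP[_ /eqP] := forall_inP simpleG e eG.
have def_q v : tree_seq (component_graph A v) = orders A v by rewrite ffunE.
have v_root v : (0 < index v (orders A v)) = false -> lower (orders A) A v = set0.
  by rewrite (lower_neq0 v cmp) => /negbFE/eqP.
have card1 v : #|lower (orders A) A v| <= 1 -> 0 < index v (orders A v) ->
    exists2 p, lower (orders A) A v = [set p] & p \in window_nbrs (orders A) (edges G) v.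
  move=> le1 v_gt0; have : #|lower (orders A) A v| == 1.
    by rewrite eqn_leq le1 card_gt0 -(lower_neq0 v cmp).
  case/cards1P=> p def_p; exists p => //.
  by apply: (subsetP (lower_sub v cmp subAG)); rewrite def_p set11.
apply/idP/forallP=> [/andP[/and3P[_ _ acA] /forall_inP even_left] v|leftA].
  have [v_gt0|] := boolP (0 < index v (orders A v)); last first.
    by move/negbTE; rewrite /leftmost_at => ->.
  have [p def_p pW] := card1 v (acyclic_lower v acA) v_gt0.
  rewrite def_p leftmost_atE // -N_setE // -M_setE // v_gt0 /=.
  have [|evenA leftA] := andP (even_left (component A v) _).
    by rewrite components_spanning imset_f.
  move/forall_inP/(_ v (component_refl A v)): evenA.
  move/forall_inP/(_ v (component_refl A v)): leftA.
  by rewrite /pos def_q v_gt0 /= => -> ->.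
have lower1 v : #|lower (orders A) A v| <= 1.
  have := leftA v; rewrite /leftmost_at.
  case v_gt0: (0 < _); last by rewrite v_root // cards0.
  by case/andP=> _ /exists_inP[s _ /andP[/eqP-> _]]; rewrite cards1.
apply/andP; split.
  by apply/and3P; split; [rewrite vertG | | exact: lower_acyclic].
rewrite components_spanning; apply/forall_inP=> _ /imsetP[x _ ->].
(* The component is renamed after [v], since the formulas for $N$ and $M$ refer to the component of
   the vertex itself. *)
have vert_ok v : v \in component A x -> 0 < pos (component_graph A x) v ->
    ~~ odd #|N_set (induced G (component A x)) (component_graph A x) v| &&
    (M_set (induced G (component A x)) (component_graph A x) v == set0).
  move=> vx; have eq_vx := component_eq vx; rewrite /component_graph -eq_vx.
  rewrite -/(component_graph A v) /pos def_q => v_gt0.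
  have [p def_p pW] := card1 v (lower1 v) v_gt0.
  by have := leftA v; rewrite def_p leftmost_atE // -N_setE // -M_setE // v_gt0.
apply/andP; split; apply/forall_inP=> v vx; apply/implyP=> v_gt0;
  by case/andP: (vert_ok v vx v_gt0).
Qed.

(** * Comparison of the two counts *)

Lemma prod_bool (R : comNzRingType) (I : finType) (P : pred I) :
  (\prod_i (P i)%:R = [forall i, P i]%:R :> R)%R.
Proof.
case: forallP => [allP|/forallP]; first by rewrite big1 // => i _; rewrite allP.
by rewrite negb_forall => /existsP[i /negPf nPi]; rewrite (bigD1 i) //= nPi mul0r.
Qed.

Lemma card_even_left_forest n (G : graph n) :
    vert G = [set: 'I_n] ->
  #|[set F : graph n | even_left_forest G F]| =
  \sum_(A : {set {set 'I_n}} | A \subset edges G) even_left_forest G (spanning A).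
Proof.
move=> vertG; rewrite -big_mkcondr sum1_card /=.
rewrite -(card_in_imset (f := @spanning n)) => [|A B _ _ [] //].
apply: eq_card => F; rewrite inE; apply/idP/imsetP=> [elF|[A]]; last first.
  by rewrite unfold_in => /andP[_ elA] ->.
have /andP[/and3P[/eqP vF subF _] _] := elF.
have defF : F = spanning (edges F) by case: F vF {elF subF} => V A /= ->; rewrite vertG.
by exists (edges F); rewrite // unfold_in subF -defF.
Qed.

Local Open Scope ring_scope.

Theorem theorem1p1 (n : nat) (G : graph n)
    (vertG : vert G = [set: 'I_n]) (simpleG : simple G) (connG : connected G) :
  tutte G (2 : int) (-1) = #|[set F : graph n | even_left_forest G F]|%:Z.
Proof.
have simpleE : {in edges G, forall e : {set 'I_n}, #|e| = 2%N}.
  by move=> e eG; have /andP[_ /eqP] := forall_inP simpleG e eG.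
have -> : tutte G (2 : int) (-1) =
    \sum_(A : {set {set 'I_n}} | A \subset edges G)
      \prod_v (-2) ^+ #|lower (orders A) A v|.-1.
  rewrite /tutte; apply: eq_big => A; first by rewrite powersetE.
  (* At this point [x - 1] is 1, so the first factor vanishes from each term, and [y - 1] is -2. *)
  rewrite powersetE => subAE; rewrite addrK expr1n mul1r.
  rewrite corank_lower // => [|e /(subsetP subAE)]; last exact: simpleE.
  by rewrite -prodrXr.
have -> : #|[set F : graph n | even_left_forest G F]|%:Z =
    \sum_(A : {set {set 'I_n}} | A \subset edges G)
      \prod_v (leftmost_at (orders A) (edges G) v (lower (orders A) A v))%:R.
  rewrite card_even_left_forest // -natz natr_sum; apply: eq_bigr => A subAE.
  by rewrite prod_bool even_left_forestE.
apply: (eq_sum_fibers (f := @orders n)) => B.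
(* The weight may depend on the search result, which is constant on the fibre of [B]. *)
have fiber (w : {ffun 'I_n -> seq 'I_n} -> 'I_n -> {set 'I_n} -> int) :
    \sum_(A : {set {set 'I_n}} | (A \subset edges G) && (orders A == orders B))
      \prod_v w (orders A) v (lower (orders A) A v) =
    \prod_v \sum_(S : {set 'I_n} | (S \subset window_nbrs (orders B) (edges G) v) &&
        ((0 < index v (orders B v))%N ==> (S != set0))) w (orders B) v S.
  rewrite -(sum_orders _ simpleE (orders_block B)).
  by apply: eq_bigr => A /andP[_ /eqP->].
rewrite (fiber (fun _ _ S => (-2) ^+ #|S|.-1)).
rewrite (fiber (fun q v S => (leftmost_at q (edges G) v S)%:R)).
by apply: eq_bigr => v _; apply: sum_vertex.
Qed.
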